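(* For every relation instance $r$ of a relation schema $R=\{A_1,\dots,A_m\}$, the DUD algorithm run on $r$ discovers the true UCCs correctly: it outputs exactly the set of all minimal UCCs of $r$ (every attribute set it outputs is a minimal UCC of $r$, and every minimal UCC of $r$ is output).
   Context: A relation schema $R=\{A_1,\dots,A_m\}$ is a finite set of attributes; a relation instance $r$ is a finite collection of $n$ tuples, where a tuple $t$ assigns to each $A\in R$ a value $t[A]$. For $X\subseteq R$, $t[X]$ is the projection of $t$ on $X$; $t_1[X]=t_2[X]$ means $t_1[A]=t_2[A]$ for all $A\in X$. An attribute set $X\subseteq R$ is a UCC (unique column combination) of $r$ if $t_1[X]\neq t_2[X]$ for all distinct $t_1,t_2\in r$; a UCC is minimal if no proper subset of it is a UCC. The difference set of two distinct tuples is $DS(t_1,t_2)=\{A\in R: t_1[A]\neq t_2[A]\}$. A hypergraph is a pair $(V,E)$ with $V$ a finite set and $E$ a set of subsets of $V$. A hitting set is a set $h\subseteq V$ with $h\cap e\ne\emptyset$ for all $e\in E$; it is minimal if it does not properly contain any other hitting set. $Tr(\mathcal{H})$ is the set of minimal hitting sets of $\mathcal{H}$. For each attribute $A_i$, $cmp_i$ is the number of unordered pairs of distinct tuples of $r$ agreeing on $A_i$. Given a bound $\gamma$ (by default $\gamma=3n\log_2 n$), $A_i$ is of FG type if $cmp_i\le\gamma$ and of NG type otherwise; $S_{NG}$ is the set of attributes of NG type. The DUD algorithm works as follows. Phase 1: Generate $DS(t_1,t_2)$ for all pairs of distinct tuples that agree on at least one attribute of FG type. In addition, draw a uniform random sample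 of $\sqrt{n\cdot|S_{NG}|}$ tuples of $r$ and generate the difference sets of all pairs of sampled tuples. Let $\mathcal{H}=(R,E)$, where $E$ is the set of inclusion-wise minimal members of the generated difference sets. Set $ST_{ucc}=\emptyset$. Phase 2: Compute the candidate set $ST_c=Tr(\mathcal{H})$ and replace $ST_c$ by $ST_c\setminus ST_{ucc}$. If $ST_c=\emptyset$, stop and output $ST_{ucc}$. Phase 3: Set $\Delta_{DS}=\emptyset$. Every $X\in ST_c$ containing at least one attribute of FG type is put into $ST_{ucc}$ without further checking. Every other $X\in ST_c$ is validated on $r$: the tuples of $r$ are grouped by their projection on $X$ (via hashing). If no two distinct tuples have the same projection on $X$, then $X$ is put into $ST_{ucc}$. Otherwise $X$ is invalid, and for every group of at least two tuples with the same projection on $X$ the difference sets of all pairs of tuples in the group are added to $\Delta_{DS}$. If $\Delta_{DS}=\emptyset$, stop and output $ST_{ucc}$. Otherwise add the members of $\Delta_{DS}$ to the hyperedges of $\mathcal{H}$ (keeping only inclusion-wise minimal hyperedges) and return to Phase 2. *)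

(* Defs.v *)
From HB Require Import structures.
From mathcomp Require Import all_boot all_order all_algebra.
From mathcomp Require Import reals.

Set Implicit Arguments.
Unset Strict Implicit.
Unset Printing Implicit Defensive.

Import Order.TTheory GRing.Theory Num.Theory.

(* A relation schema is a finType R of attributes. A relation instance is a
   family r : 'I_n -> R -> D, where r t A is the value t[A]. The tuples are
   identified by their index, so that r may contain equal rows, and "distinct
   tuples" are distinct indices; sets of tuples are the injective families. *)

Section Relation.
Variables (R : finType) (D : eqType) (n : nat) (r : 'I_n -> R -> D).
Implicit Types (X : {set R}) (A : R) (t : 'I_n) (S : {set 'I_n}).

(* t1[X] = t2[X] *)
Definition same_proj X t1 t2 : bool := [forall A in X, r t1 A == r t2 A].

Definition ucc X : bool :=
  [forall t1, forall t2, (t1 != t2) ==> ~~ same_proj X t1 t2].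

Definition minimal_uccs : {set {set R}} := [set X | minset ucc X].

Definition diff_set t1 t2 : {set R} := [set A | r t1 A != r t2 A].

Definition diff_sets_of S : {set {set R}} :=
  [set diff_set p.1 p.2 | p in setX S S & p.1 != p.2].

(* The condition p.1 < p.2 on indices counts each unordered pair once. *)
Definition cmp A : nat :=
  #|[set p : 'I_n * 'I_n | (p.1 < p.2)%N && (r p.1 A == r p.2 A)]|.

Definition groups X : {set {set 'I_n}} :=
  equivalence_partition (same_proj X) [set: 'I_n].

End Relation.

Section Hypergraph.
Variable V : finType.
Implicit Types (E : {set {set V}}) (h : {set V}).

Definition hitting_set E h : bool := [forall e in E, h :&: e != set0].

Definition Tr E : {set {set V}} := [set h | minset (hitting_set E) h].

Definition min_edges E : {set {set V}} := [set e | minset [in E] e].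

End Hypergraph.

Section DUD.
Variables (K : realType) (R : finType) (D : eqType) (n : nat).
Variables (r : 'I_n -> R -> D) (gamma : K).
Implicit Types (X : {set R}) (E ST out : {set {set R}}) (S : {set 'I_n}).

Definition FG : {set R} := [set A | ((cmp r A)%:R <= gamma)%R].
Definition NG : {set R} := ~: FG.

(* The possible outcomes of the random draw. The number sqrt (n * #|NG|) may be
   rounded either way to an integer s, and at most n tuples can be drawn. *)
Definition possible_sample S : Prop :=
  exists2 s : nat,
    (`|s%:R - Num.sqrt ((n * #|NG|)%:R : K)| < 1)%R & #|S| = minn s n.

Definition initial_edges S : {set {set R}} :=
  min_edges
    ([set diff_set r p.1 p.2 | p : 'I_n * 'I_n
        & (p.1 != p.2) && [exists A in FG, r p.1 A == r p.2 A]]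
     :|: diff_sets_of r S).

Definition candidates E ST : {set {set R}} := Tr E :\: ST.

Definition unchecked X : bool := X :&: FG != set0.

Definition accepted E ST : {set {set R}} :=
  [set X in candidates E ST | unchecked X || ucc r X].

Definition delta_DS E ST : {set {set R}} :=
  \bigcup_(X in candidates E ST | ~~ unchecked X && ~~ ucc r X)
    \bigcup_(g in groups r X | (1 < #|g|)%N) diff_sets_of r g.

(* dud_loop E ST out: with hyperedges E and confirmed set ST, and the candidate
   set about to be computed, the algorithm stops after finitely many rounds with
   output out. *)
Inductive dud_loop : {set {set R}} -> {set {set R}} -> {set {set R}} -> Prop :=
| DudNoCandidate E ST :
    candidates E ST = set0 -> dud_loop E ST ST
| DudNoDelta E ST :
    candidates E ST <> set0 -> delta_DS E ST = set0 ->
    dud_loop E ST (ST :|: accepted E ST)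
| DudNextRound E ST out :
    candidates E ST <> set0 -> delta_DS E ST <> set0 ->
    dud_loop (min_edges (E :|: delta_DS E ST)) (ST :|: accepted E ST) out ->
    dud_loop E ST out.

Definition dud_outputs S out : Prop := dud_loop (initial_edges S) set0 out.

End DUD.

(* Main.v *)
Require Import Defs.
From mathcomp Require Import all_boot all_order all_algebra.
From mathcomp Require Import reals.

(** A set [X] is a UCC iff it hits every difference set. Throughout a run the
    hyperedges are difference sets, so every UCC is a hitting set, and a minimal
    hitting set that is a UCC is a minimal UCC. A hitting set with an attribute
    [A] of FG type is a UCC: pairs that agree on [A] were all covered in Phase 1,
    and the others are told apart by [A]. When the loop stops, all minimal hitting
    sets are confirmed, and every minimal UCC contains one of them. Each further
    round kills the invalid candidate, so the number of hitting sets decreases. *)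

Set Implicit Arguments.
Unset Strict Implicit.
Unset Printing Implicit Defensive.

Section Hypergraph.
Variable V : finType.
Implicit Types (E : {set {set V}}) (h : {set V}).

Lemma hitting_setP E h :
  reflect (forall e, e \in E -> h :&: e != set0) (hitting_set E h).
Proof. exact: forall_inP. Qed.

(** Every edge contains an inclusion-wise minimal one, and a set that meets the smaller edge meets
    the larger. Pruning edges is therefore harmless throughout. *)
Lemma hitting_set_min_edges E : hitting_set (min_edges E) =1 hitting_set E.
Proof.
move=> h; apply/hitting_setP/hitting_setP => hitE e eE.
- have [f fmin sfe] := minset_exists (P := [in E]) eE.
  have := hitE f; rewrite inE => /(_ fmin).
  by apply: contra_neq => he0; apply/eqP; rewrite -subset0 -he0 setIS.
- by apply: hitE; move: eE; rewrite inE => /minsetp.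
Qed.

Lemma hitting_setU E1 E2 h :
  hitting_set (E1 :|: E2) h = hitting_set E1 h && hitting_set E2 h.
Proof.
apply/hitting_setP/andP => [hitE | [/hitting_setP hit1 /hitting_setP hit2] e].
- by split; apply/hitting_setP => e eE; apply: hitE; rewrite inE eE ?orbT.
- by rewrite inE => /orP[/hit1 | /hit2].
Qed.

Lemma Tr_hitting E h : h \in Tr E -> hitting_set E h.
Proof. by rewrite inE => /minsetp. Qed.

End Hypergraph.

Section Relation.
Variables (R : finType) (D : eqType) (n : nat) (r : 'I_n -> R -> D).
Implicit Types (X : {set R}) (E : {set {set R}}).

Lemma same_projE X t1 t2 : same_proj r X t1 t2 = (X :&: diff_set r t1 t2 == set0).
Proof.
rewrite setI_eq0 disjoint_subset.
apply/forall_inP/subsetP => H A AX; first by rewrite !inE negbK H.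
by have := H A AX; rewrite !inE negbK.
Qed.

Lemma uccP X :
  reflect (forall t1 t2, t1 != t2 -> X :&: diff_set r t1 t2 != set0) (ucc r X).
Proof.
apply: (iffP forallP) => [H t1 t2 ne | H t1].
- by rewrite -same_projE; apply: (implyP (forallP (H t1) t2)).
- by apply/forallP => t2; apply/implyP; rewrite same_projE; apply: H.
Qed.

Lemma ucc_hitting E :
  (forall e, e \in E -> exists t1 t2, t1 != t2 /\ e = diff_set r t1 t2) ->
  forall X, ucc r X -> hitting_set E X.
Proof.
move=> dsE X /uccP uccX; apply/hitting_setP => e /dsE [t1 [t2 [ne ->]]].
exact: uccX.
Qed.

Lemma diff_sets_ofP (S : {set 'I_n}) e :
  reflect (exists t1 t2, [/\ t1 \in S, t2 \in S, t1 != t2 & e = diff_set r t1 t2])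
          (e \in diff_sets_of r S).
Proof.
apply: (iffP imsetP) => [[[t1 t2]] | [t1 [t2 [S1 S2 ne ->]]]].
- by rewrite !inE /= => /andP[/andP[S1 S2] ne] ->; exists t1, t2.
- by exists (t1, t2); rewrite // !inE /= S1 S2.
Qed.

(** A UCC inside [X] is again a hitting set, so minimality of [X] among hitting sets makes it equal
    to [X]. *)
Lemma Tr_ucc_minimal E X :
  (forall Y, ucc r Y -> hitting_set E Y) ->
  X \in Tr E -> ucc r X -> X \in minimal_uccs r.
Proof.
move=> uccE; rewrite !inE => /minsetP[_ minX] uccX.
by apply/minsetP; split=> // Y /uccE hitY; apply: minX.
Qed.

(** This is the stopping criterion. A minimal UCC [Y] contains some minimal hitting set [h]; as [h]
    lies in [ST] it is a UCC, so [h = Y]. *)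
Lemma sub_minimal_uccs E (ST : {set {set R}}) :
  (forall Y, ucc r Y -> hitting_set E Y) ->
  ST \subset minimal_uccs r -> Tr E \subset ST -> ST = minimal_uccs r.
Proof.
move=> uccE sST sTr; apply/eqP; rewrite eqEsubset sST /=.
apply/subsetP => Y; rewrite inE => /minsetP[/uccE hitY minY].
have [h hmin shY] := minset_exists hitY.
have hST : h \in ST by apply: (subsetP sTr); rewrite inE.
have := subsetP sST h hST; rewrite inE => /minsetp ucch.
by rewrite -(minY h).
Qed.

End Relation.

Section DUD.
Variables (K : realType) (R : finType) (D : eqType) (n : nat).
Variables (r : 'I_n -> R -> D) (gamma : K).
Implicit Types (X : {set R}) (E ST out : {set {set R}}) (S : {set 'I_n}).

(** [unchecked_ucc] speaks of all hitting sets, not only the minimal ones: new edges can create new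
    minimal hitting sets, but never new hitting sets, so the property passes to later rounds. *)
Record dud_invariant E ST : Prop := DudInvariant {
  ucc_hits : forall X, ucc r X -> hitting_set E X;
  unchecked_ucc : forall X, hitting_set E X -> unchecked r gamma X -> ucc r X;
  confirmed_minimal : ST \subset minimal_uccs r }.

Lemma delta_DSP E ST e :
  e \in delta_DS r gamma E ST ->
  exists X t1 t2, [/\ X \in Tr E, t1 != t2, e = diff_set r t1 t2
                    & X :&: e = set0].
Proof.
case/bigcupP=> X /andP[]; rewrite inE => /andP[_ XTr] _.
case/bigcupP=> g /andP[/imsetP[t _ ->] _] /diff_sets_ofP[t1 [t2 [g1 g2 ne ->]]].
exists X, t1, t2; split=> //; apply/eqP; rewrite -same_projE.
(* Both tuples agree on [X] with the representative [t] of their group, hence with each other. *)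
move: g1 g2; rewrite !inE /= => /forall_inP e1 /forall_inP e2.
by apply/forall_inP => A AX; rewrite -(eqP (e1 A AX)) e2.
Qed.

Lemma delta_DS_eq0 E ST :
  delta_DS r gamma E ST = set0 -> candidates E ST \subset accepted r gamma E ST.
Proof.
move=> d0; apply/subsetP => X Xc; rewrite inE Xc /=.
apply: contraT; rewrite negb_or => nX.
case/andP: (nX) => _ /forallPn[t1 /forallPn[t2]].
rewrite negb_imply negbK => /andP[ne same].
suff: diff_set r t1 t2 \in delta_DS r gamma E ST by rewrite d0 inE.
apply/bigcupP; exists X; first by rewrite Xc.
(* The group of [t1], in the form in which [equivalence_partition] builds its blocks. *)
pose g := [set t in [set: 'I_n] | same_proj r X t1 t].
have g1 : t1 \in g by rewrite !inE; apply/forall_inP.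
have g2 : t2 \in g by rewrite !inE.
apply/bigcupP; exists g; last by apply/diff_sets_ofP; exists t1, t2.
by rewrite imset_f ?inE //=; apply/card_gt1P; exists t1, t2.
Qed.

Lemma accepted_minimal E ST :
  dud_invariant E ST -> ST :|: accepted r gamma E ST \subset minimal_uccs r.
Proof.
case=> hits unch sST; rewrite subUset sST; apply/subsetP => X.
rewrite inE => /andP[]; rewrite inE => /andP[_ XTr] uX.
apply: (Tr_ucc_minimal hits XTr).
by case/orP: uX => //; apply: unch; apply: Tr_hitting.
Qed.

Lemma dud_invariant_next E ST :
  dud_invariant E ST ->
  dud_invariant (min_edges (E :|: delta_DS r gamma E ST))
                (ST :|: accepted r gamma E ST).
Proof.
move=> inv; split; last exact: accepted_minimal.
- move=> X uccX; rewrite hitting_set_min_edges hitting_setU (ucc_hits inv) //.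
  apply: ucc_hitting uccX => e /delta_DSP[Y [t1 [t2 [_ ne -> _]]]].
  by exists t1, t2.
- move=> X; rewrite hitting_set_min_edges hitting_setU => /andP[hitX _].
  exact: (unchecked_ucc inv).
Qed.

Lemma dud_invariant_initial S : dud_invariant (initial_edges r gamma S) set0.
Proof.
split; last exact: sub0set.
- move=> X; rewrite hitting_set_min_edges; apply: ucc_hitting => e.
  rewrite inE => /orP[/imsetP[[t1 t2]] | /diff_sets_ofP[t1 [t2 [_ _ ne ->]]]].
  + by rewrite inE /= => /andP[ne _] ->; exists t1, t2.
  + by exists t1, t2.
- move=> X; rewrite hitting_set_min_edges hitting_setU.
  case/andP=> /hitting_setP hitX _ /set0Pn[A]; rewrite inE => /andP[AX AFG].
  (* If the pair agrees on the FG attribute [A], its difference set was generated in Phase 1 and [X]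
     hits it; otherwise [A] itself lies in the intersection. *)
  apply/uccP => t1 t2 ne; have [eqA | neA] := boolP (r t1 A == r t2 A).
  + apply: hitX; apply/imsetP; exists (t1, t2) => //.
    by rewrite inE /= ne; apply/existsP; exists A; rewrite AFG.
  + by apply/set0Pn; exists A; rewrite !inE AX.
Qed.

Lemma dud_loop_minimal_uccs E ST out :
  dud_loop r gamma E ST out -> dud_invariant E ST -> out = minimal_uccs r.
Proof.
elim=> {E ST out} [E ST c0 | E ST _ d0 | E ST out _ _ _ IH] inv.
- apply: (sub_minimal_uccs (ucc_hits inv) (confirmed_minimal inv)).
  by rewrite -setD_eq0; apply/eqP.
- apply: (sub_minimal_uccs (ucc_hits inv) (accepted_minimal inv)).
  (* [Tr E] lies in the union of [ST] and the accepted sets because the candidates [Tr E :\: ST]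
     were all accepted. *)
  by rewrite -subDset; apply: delta_DS_eq0.
- by apply: IH; apply: dud_invariant_next.
Qed.

Lemma dud_loop_terminates E ST : exists out, dud_loop r gamma E ST out.
Proof.
have [k] := ubnP #|[set h | hitting_set E h]|.
elim: k E ST => // k IH E ST ltk.
have [c0 | /eqP c0] := eqVneq (candidates E ST) set0.
  by exists ST; apply: DudNoCandidate.
have [d0 | dn0] := eqVneq (delta_DS r gamma E ST) set0.
  by exists (ST :|: accepted r gamma E ST); apply: DudNoDelta.
have [|out run] := IH (min_edges (E :|: delta_DS r gamma E ST))
                       (ST :|: accepted r gamma E ST); last first.
  by exists out; apply: DudNextRound => //; apply/eqP.
have /set0Pn[e ed] := dn0.
have [X [t1 [t2 [XTr _ _ Xe0]]]] := delta_DSP ed.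
(* The hitting sets for the enlarged edge set form a proper subset of the old ones: [X] is lost,
   being disjoint from the new edge [e]. *)
apply: leq_trans (ltk : _ <= k); apply: proper_card; apply/properP; split.
  apply/subsetP => h; rewrite !inE hitting_set_min_edges hitting_setU.
  by case/andP.
exists X; first by rewrite inE Tr_hitting.
rewrite inE hitting_set_min_edges hitting_setU negb_and; apply/orP; right.
by apply/negP => /hitting_setP/(_ e ed); rewrite Xe0 eqxx.
Qed.

End DUD.

Theorem theorem4p4 (K : realType) (R : finType) (D : eqType) (n : nat)
    (r : 'I_n -> R -> D) (gamma : K) (S : {set 'I_n}) :
  possible_sample r gamma S ->
  forall out : {set {set R}},
    dud_outputs r gamma S out <-> out = minimal_uccs r.
Proof.
move=> _ out.
have correct o : dud_outputs r gamma S o -> o = minimal_uccs r.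
  by move/dud_loop_minimal_uccs; apply; apply: dud_invariant_initial.
split=> [|->]; first exact: correct.
(* For the converse, some run ends with an output [o], and correctness identifies [o] with
   [minimal_uccs r]. *)
have [o run] := dud_loop_terminates r gamma (initial_edges r gamma S) set0.
by rewrite -(correct o run).
Qed.
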